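(* For each integer $n\ge 1$ consider the Hegselmann--Krause system with $n$ non-strategic agents and starting opinions $x_i(0)=i-1$ for all $1\le i\le n$ (the equidistant configuration). As $n\to\infty$, the convergence time of this system without strategic agents ($m=0$) is in $\Omega(n)$, while its optimal convergence time for $m=1$ strategic agent is in $O\left(n^{3/4}\right)$.
   Context: One-dimensional Hegselmann--Krause (HK) system with strategic agents: there is a set $N=\{1,\dots,n\}$ of non-strategic agents and a disjoint set $S$ of $m=|S|$ strategic agents; $A=N\cup S$. At each discrete time $t\in\mathbb{N}_{\ge 0}$ every agent $i\in A$ has an opinion $x_i(t)\in\mathbb{R}$. The starting opinions $x_i(0)$, $i\in N$, are given. The opinions $x_s(t)$ of the strategic agents $s\in S$ can be chosen freely (as any real numbers) at every time $t$. For $i\in N$, $$x_i(t+1)=\frac{1}{|\mathcal{N}_i(t)|}\sum_{j\in\mathcal{N}_i(t)}x_j(t),\qquad \mathcal{N}_i(t)=\{j\in A: |x_i(t)-x_j(t)|\le 1\}.$$ The system has converged at time $t$ if for all $i,j\in N$ either $x_i(t)=x_j(t)$ or $|x_i(t)-x_j(t)|>1$. The convergence time is the smallest $t\in\mathbb{N}_{\ge 0}$ such that the system has converged at time $t$. For given starting opinions of the non-strategic agents and given $m$, the optimal convergence time is the minimum of the convergence time over all choices of the opinions of the $m$ strategic agents at all times. *)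

(* Defs.v *)
From HB Require Import structures.
From mathcomp Require Import all_boot all_order all_algebra.
From mathcomp Require Import all_classical all_reals all_analysis.

Set Implicit Arguments.
Unset Strict Implicit.
Unset Printing Implicit Defensive.

Import Order.TTheory GRing.Theory Num.Theory.
Import numFieldNormedType.Exports.

Local Open Scope ring_scope.

(** Non-strategic agents are indexed by ['I_n], strategic agents by ['I_m],
    so the set of all agents is the disjoint sum ['I_n + 'I_m]. *)
Section HegselmannKrause.
Variables (R : realType) (n m : nat).
Implicit Types (x : 'I_n -> R) (y : 'I_m -> R).

Definition opinion x y (a : 'I_n + 'I_m) : R :=
  match a with inl i => x i | inr s => y s end.

Definition neighbours x y (i : 'I_n) : {set 'I_n + 'I_m} :=
  [set a | `|x i - opinion x y a| <= 1].

Definition hk_step x y (i : 'I_n) : R :=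
  (\sum_(a in neighbours x y i) opinion x y a) / #|neighbours x y i|%:R.

(** [y t] gives the opinions of the strategic agents at time [t]; the dynamics
    is deterministic, so fixing the whole sequence in advance loses nothing
    against choosing [y t] after seeing the state at time [t]. *)
Fixpoint hk (x0 : 'I_n -> R) (y : nat -> 'I_m -> R) (t : nat) : 'I_n -> R :=
  if t is t'.+1 then hk_step (hk x0 y t') (y t') else x0.

Definition converged x : Prop :=
  forall i j : 'I_n, x i = x j \/ 1 < `|x i - x j|.

Definition is_convergence_time (x0 : 'I_n -> R) (y : nat -> 'I_m -> R)
    (t : nat) : Prop :=
  converged (hk x0 y t) /\
  forall t' : nat, converged (hk x0 y t') -> (t <= t')%N.

End HegselmannKrause.

(** The minimum over all strategies; strategies under which the system never
    converges have no convergence time, i.e. count as [+oo]. *)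
Definition is_optimal_convergence_time (R : realType) (n m : nat)
    (x0 : 'I_n -> R) (t : nat) : Prop :=
  (exists y : nat -> 'I_m -> R, is_convergence_time x0 y t) /\
  forall (y : nat -> 'I_m -> R) (t' : nat),
    is_convergence_time x0 y t' -> (t <= t')%N.
Arguments is_optimal_convergence_time {R n} m x0 t.

Definition no_strategic (R : realType) : nat -> 'I_0 -> R := fun _ _ => 0.
Arguments no_strategic {R}.

(** Agent [i : 'I_n] is agent number [i + 1], with opinion [(i + 1) - 1]. *)
Definition equidistant (R : realType) (n : nat) : 'I_n -> R := fun i => i%:R.

(* Main.v *)
(* Lower bound: a disturbance of the equidistant chain travels at most one agent
   per step inwards from each end, so two agents in the middle stay at distance
   exactly 1 for about n/2 steps.

   Upper bound: an isolated group of N agents of diameter D that evolves freely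
   converges in O(N^2 D + N) steps, since in every two steps either its leftmost
   opinion rises by 1/(2 N^2) or its leftmost cluster has merged and split off.
   A strategic agent placed on an undisturbed agent of the chain cuts the chain
   in one step.  Cutting off blocks of W agents alternately from the left and
   from the right, always ahead of the disturbance, takes about n/W steps and
   leaves blocks of O(W) agents; these converge simultaneously in O(W^3) further
   steps, and W of order n^(1/4) balances the two phases. *)
Require Import Defs.
From mathcomp Require Import all_boot all_order all_algebra.
From mathcomp Require Import all_classical all_reals all_analysis.
From mathcomp Require Import ring lra zify.
Import Order.TTheory GRing.Theory Num.Theory.
Import numFieldNormedType.Exports.
Set Implicit Arguments.
Unset Strict Implicit.
Unset Printing Implicit Defensive.
Local Open Scope ring_scope.

(** * Averages over finite sets *)

Section Mean.
Variables (R : realType) (T : finType).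
Implicit Types (A B : {set T}) (f : T -> R).

Definition mean A f : R := (\sum_(a in A) f a) / #|A|%:R.

Lemma mean_sub A f c a0 : a0 \in A ->
  mean A f - c = (\sum_(a in A) (f a - c)) / #|A|%:R.
Proof.
move=> Aa0; have cA : #|A|%:R != 0 :> R.
  by rewrite pnatr_eq0 -lt0n; apply/card_gt0P; exists a0.
by rewrite sumrB sumr_const mulrBl -[c *+ _]mulr_natr mulfK.
Qed.

Lemma le_mean A f c a0 : a0 \in A ->
  (c <= mean A f) = (0 <= \sum_(a in A) (f a - c)).
Proof.
move=> Aa0; rewrite -subr_ge0 (mean_sub _ _ Aa0) pmulr_lge0 //.
by rewrite invr_gt0 ltr0n; apply/card_gt0P; exists a0.
Qed.

Lemma mean_ge A f c a0 : a0 \in A -> {in A, forall a, c <= f a} -> c <= mean A f.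
Proof.
move=> Aa0 h; rewrite (le_mean _ _ Aa0); apply: sumr_ge0 => a /h.
by rewrite subr_ge0.
Qed.

Lemma meanN A f : mean A (fun a => - f a) = - mean A f.
Proof. by rewrite /mean sumrN mulNr. Qed.

Lemma mean_le A f c a0 : a0 \in A -> {in A, forall a, f a <= c} -> mean A f <= c.
Proof.
move=> Aa0 h; rewrite -lerN2 -meanN; apply: (mean_ge Aa0) => a /h.
by rewrite lerN2.
Qed.

Lemma mean_gt A f c a0 : a0 \in A -> {in A, forall a, c <= f a} -> c < f a0 ->
  c < mean A f.
Proof.
move=> Aa0 h ca0; rewrite -subr_gt0 (mean_sub _ _ Aa0) pmulr_lgt0; last first.
  by rewrite invr_gt0 ltr0n; apply/card_gt0P; exists a0.
rewrite (bigD1 a0) //= ltr_pwDl ?subr_gt0 //.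
by apply: sumr_ge0 => a /andP[/h]; rewrite subr_ge0.
Qed.

Lemma mean_lt A f c a0 : a0 \in A -> {in A, forall a, f a <= c} -> f a0 < c ->
  mean A f < c.
Proof.
move=> Aa0 h ca0; rewrite -ltrN2 -meanN; apply: (mean_gt Aa0).
  by move=> a /h; rewrite lerN2.
by rewrite ltrN2.
Qed.

Lemma mean_ge_jump A f c d N a0 : a0 \in A -> (#|A| <= N)%N -> 0 <= d ->
  d <= \sum_(a in A) (f a - c) -> c + d / N%:R <= mean A f.
Proof.
move=> Aa0 AN d0 hd; rewrite -lerBrDl (mean_sub _ _ Aa0).
have A0 : (0 < #|A|)%N by apply/card_gt0P; exists a0.
have A0' : 0 < #|A|%:R^-1 :> R by rewrite invr_gt0 ltr0n.
apply: (@le_trans _ _ (d / #|A|%:R)); last by rewrite ler_pM2r.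
by rewrite ler_wpM2l // lef_pV2 ?posrE ?ltr0n ?ler_nat // (leq_trans A0).
Qed.

(* If some element outside [B] exceeds the mean of [A], then so does all of
   [B]; otherwise dropping [A :\: B] can only raise the mean. *)
Lemma mean_mono A B f a0 b0 : a0 \in A -> b0 \in B ->
  (forall a b, a \in A -> a \notin B -> b \in B -> f a <= f b) ->
  (forall a b, a \in A -> b \in B -> b \notin A -> f a <= f b) ->
  mean A f <= mean B f.
Proof.
move=> Aa0 Bb0 hA hB; set c := mean A f.
have [[a [Aa Ba ca]]|/forallNP nex] := pselect (exists a,
    [/\ a \in A, a \notin B & c < f a]).
  apply: (mean_ge Bb0) => b Bb.
  exact: le_trans (ltW ca) (hA _ _ Aa Ba Bb).
rewrite (le_mean _ _ Bb0) (bigID (mem A)) /=; apply: addr_ge0; last first.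
  apply: sumr_ge0 => b /andP[Bb Ab]; rewrite subr_ge0.
  by apply: (mean_le Aa0) => a Aa; exact: hB.
(* Deviations from the mean of [A] cancel; those outside [B] are nonpositive by [nex], so those in
   the intersection add up to something nonnegative. *)
have : \sum_(a in A) (f a - c) = 0.
  have cA : #|A|%:R^-1 != 0 :> R.
    by rewrite invr_eq0 pnatr_eq0 -lt0n; apply/card_gt0P; exists a0.
  by apply/eqP; rewrite -(mulIr_eq0 _ (mulIf cA)) -(mean_sub _ _ Aa0) subrr.
rewrite (bigID (mem B)) /= => /eqP; rewrite addr_eq0 => /eqP hs.
rewrite (eq_bigl (fun a => (a \in A) && (a \in B))); last first.
  by move=> a; rewrite /= andbC.
rewrite hs oppr_ge0; apply: sumr_le0 => a /andP[Aa Ba]; rewrite subr_le0.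
by rewrite leNgt; apply/negP => ca; apply: (nex a).
Qed.

End Mean.

(** * Isolated groups evolving without strategic agents *)

Section Free.
Variables (R : realType) (T : finType).
Implicit Types (x : T -> R) (B : {set T}).

Definition near_agents x i : {set T} := [set j | `|x i - x j| <= 1].

Definition free_step x i : R := mean (near_agents x i) x.

(** Nothing is required inside [B], so a group may itself break up into several clusters. *)
Definition isolated_group x B :=
  forall i j, i \in B -> j \notin B -> 1 < `|x i - x j|.

Definition converged_on x B :=
  forall i j, i \in B -> j \in B -> x i = x j \/ 1 < `|x i - x j|.

Lemma near_refl x i : i \in near_agents x i.
Proof. by rewrite inE subrr normr0. Qed.

Lemma near_isolated x B i j : isolated_group x B -> i \in B -> j \in near_agents x i ->
  j \in B.
Proof.
move=> iB Bi; rewrite inE => ij; apply/negPn/negP => Bj.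
by have := iB _ _ Bi Bj; rewrite ltNge ij.
Qed.

Lemma near_isolatedC x B i j : isolated_group x B -> i \notin B ->
  j \in near_agents x i -> j \notin B.
Proof.
move=> iB Bi; rewrite inE => ij; apply/negP => Bj.
by have := iB _ _ Bj Bi; rewrite distrC ltNge ij.
Qed.

Lemma isolated_setD x B K : isolated_group x B -> isolated_group x K -> isolated_group x (B :\: K).
Proof.
move=> iB iK i j; rewrite !inE => /andP[Ki Bi]; rewrite negb_and negbK.
by case/orP => [Kj|Bj]; [rewrite distrC; apply: iK|apply: iB].
Qed.

Lemma free_step_ge x B c : isolated_group x B -> {in B, forall i, c <= x i} ->
  {in B, forall i, c <= free_step x i}.
Proof.
move=> iB h i Bi; apply: (mean_ge (near_refl x i)) => j ij.
exact/h/(near_isolated iB Bi ij).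
Qed.

Lemma free_step_le x B c : isolated_group x B -> {in B, forall i, x i <= c} ->
  {in B, forall i, free_step x i <= c}.
Proof.
move=> iB h i Bi; apply: (mean_le (near_refl x i)) => j ij.
exact/h/(near_isolated iB Bi ij).
Qed.

(** The two ranges have equal length: what only [i] sees lies left of the range of [j], and what
    only [j] sees lies right of the range of [i]. This is the situation of [mean_mono]. *)
Lemma free_step_mono x i j : x i <= x j -> free_step x i <= free_step x j.
Proof.
move=> xij; apply: (mean_mono (near_refl x i) (near_refl x j)) => a b;
  rewrite !inE -?ltNge !ler_norml ltr_normr.
- by move=> /andP[? ?] /orP[?|?] /andP[? ?]; lra.
- by move=> /andP[? ?] /andP[? ?] /orP[?|?]; lra.
Qed.

(** Take [i] and [j] on different sides of the boundary of [B] with [x i <= x j]. What [i] sees and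
    what [j] sees are pairwise more than 1 apart, and [x i + 1 < x j] leaves no room for the reverse
    order; averaging keeps this separation. *)
Lemma isolated_step x B : isolated_group x B -> isolated_group (free_step x) B.
Proof.
move=> iB.
have sep i j : 1 < `|x i - x j| -> x i <= x j ->
    (forall a b, a \in near_agents x i -> b \in near_agents x j ->
      1 < `|x a - x b|) ->
    1 < `|free_step x i - free_step x j|.
  move=> ij le_ij far.
  have h a b : a \in near_agents x i -> b \in near_agents x j -> x a + 1 < x b.
    move=> ia jb; have := far _ _ ia jb; move: ia jb ij.
    rewrite !inE !ler_norml !ltr_normr => /andP[? ?] /andP[? ?].
    by move=> /orP[?|?] /orP[?|?]; lra.
  have hi : {in near_agents x j, forall b, free_step x i + 1 < x b}.
    move=> b jb; rewrite -ltrBrDr; apply: (mean_lt (near_refl x i)) => [a ia|].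
      by rewrite lerBrDr ltW ?h.
    by rewrite ltrBrDr h ?near_refl.
  suff : free_step x i + 1 < free_step x j.
    by move=> ?; rewrite ltr_normr; apply/orP; right; lra.
  apply: (mean_gt (near_refl x j)) => [b /hi/ltW//|]; exact/hi/near_refl.
move=> i j Bi Bj; have [le_ij|/ltW le_ji] := leP (x i) (x j).
  apply: sep => //; first exact: iB.
  move=> a b ia jb.
  by apply: (iB); [exact: near_isolated iB Bi ia|exact: near_isolatedC iB Bj jb].
rewrite distrC; apply: sep => //; first by rewrite distrC; exact: iB.
move=> a b ja ib; rewrite distrC.
by apply: (iB); [exact: near_isolated iB Bi ib|exact: near_isolatedC iB Bj ja].
Qed.

Lemma converged_step x B : isolated_group x B -> converged_on x B ->
  {in B, free_step x =1 x}.
Proof.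
move=> iB cB i Bi; have e j : j \in near_agents x i -> x j = x i.
  move=> ij; have Bj := near_isolated iB Bi ij.
  by case: (cB i j Bi Bj) => // ; move: ij; rewrite inE ltNge => ->.
apply/eqP; rewrite eq_le; apply/andP; split.
  by apply: (mean_le (near_refl x i)) => j /e ->.
by apply: (mean_ge (near_refl x i)) => j /e ->.
Qed.

Lemma isolated_iter x B k : isolated_group x B -> isolated_group (iter k free_step x) B.
Proof. by move=> iB; elim: k => //= k; exact: isolated_step. Qed.

Lemma converged_iter x B k : isolated_group x B -> converged_on x B ->
  converged_on (iter k free_step x) B.
Proof.
move=> iB cB; suff h : {in B, iter k free_step x =1 x}.
  by move=> i j Bi Bj; rewrite !h //; exact: cB.
elim: k => //= k IH i Bi.
rewrite (converged_step (B := B)) ?IH //; first exact: isolated_iter.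
by move=> a b Ba Bb; rewrite !IH //; exact: cB.
Qed.

Lemma converged_on_setD x B K : isolated_group x K -> converged_on x K ->
  converged_on x (B :\: K) -> converged_on x B.
Proof.
move=> iK cK cBK i j Bi Bj.
have [Ki|Ki] := boolP (i \in K); have [Kj|Kj] := boolP (j \in K).
- exact: cK.
- by right; exact: iK.
- by right; rewrite distrC; exact: iK.
- by apply: cBK; rewrite inE ?Ki ?Kj.
Qed.

(** Seeing [j] lifts the mean of the leftmost agent by at least [d / N]; steps preserve the order,
    so that agent still bounds all others from below. *)
Lemma min_jump x B m d N i0 j : isolated_group x B -> (#|B| <= N)%N ->
  {in B, forall i, m <= x i} -> i0 \in B -> x i0 = m -> j \in B -> 0 <= d ->
  m + d <= x j <= m + 1 -> {in B, forall i, m + d / N%:R <= free_step x i}.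
Proof.
move=> iB BN hm Bi0 xi0 Bj d0 /andP[dj j1] i Bi.
apply: (@le_trans _ _ (free_step x i0)); last first.
  by apply: free_step_mono; rewrite xi0 hm.
apply: (mean_ge_jump (near_refl x i0)) => //.
  apply: leq_trans BN; apply/subset_leq_card/fintype.subsetP => a.
  exact: near_isolated.
rewrite (bigD1 j) /=; last by rewrite inE xi0 ler_norml; apply/andP; split; lra.
rewrite ler_wpDr; [by []| |by lra].
apply: sumr_ge0 => a /andP[i0a _]; rewrite subr_ge0; apply: hm.
exact: near_isolated iB Bi0 i0a.
Qed.

(* If no agent of [B] lies in the upper half of the leftmost agent's range [K],
   the agents seeing only [K] meet at its mean [a], and every other one, seeing
   some agent beyond [m + 1], lands at least [1 / (2 N)] above [a]. *)
Lemma min_jump_or_split x B m N i0 : isolated_group x B -> (#|B| <= N)%N ->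
  {in B, forall i, m <= x i} -> i0 \in B -> x i0 = m ->
  {in B, forall i, m + 2^-1 / N%:R / N%:R <= free_step (free_step x) i} \/
  exists K : {set T}, [/\ K \subset B, i0 \in K, isolated_group (free_step x) K &
    converged_on (free_step x) K].
Proof.
move=> iB BN hm Bi0 xi0.
have N1 : 1 <= N%:R :> R.
  by rewrite ler1n (leq_trans _ BN) //; apply/card_gt0P; exists i0.
have N0 : 0 < N%:R :> R by lra.
have [[j [Bj mj jm]]|/forallNP nex] := pselect (exists j,
    [/\ j \in B, m + 2^-1 <= x j & x j <= m + 1]).
  left; apply: free_step_ge (isolated_step iB) _ => i Bi.
  have j' : m + 2^-1 <= x j <= m + 1 by rewrite mj.
  apply: le_trans (min_jump iB BN hm Bi0 xi0 Bj _ j' Bi); last by lra.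
  by rewrite lerD2l ler_piMr ?divr_ge0 ?invf_le1 //; lra.
pose K := near_agents x i0; pose a := free_step x i0.
have KB : {subset K <= B} by move=> i; exact: near_isolated.
have Km i : i \in K -> x i < m + 2^-1.
  move=> Ki; rewrite ltNge; apply/negP => h; apply: (nex i); split => //.
    exact: KB.
  by move: Ki; rewrite inE ler_norml xi0 => /andP[? ?]; lra.
have nK i : i \in B -> i \notin K -> m + 1 < x i.
  move=> Bi; rewrite inE xi0 -ltNge ltr_normr; have := hm i Bi => h.
  by case/orP => ?; lra.
have KK i j : i \in K -> j \in K -> j \in near_agents x i.
  move=> Ki Kj; have := Km i Ki; have := Km j Kj.
  have := hm _ (KB _ Ki); have := hm _ (KB _ Kj).
  by rewrite inE ler_norml => *; apply/andP; split; lra.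
have am : a <= m + 2^-1.
  by apply: (mean_le (near_refl x i0)) => i /Km/ltW.
have ma : m <= a by apply: (mean_ge (near_refl x i0)) => i /KB/hm.
pose K0 := [set i in K | near_agents x i \subset K].
have K0a i : i \in K0 -> free_step x i = a.
  rewrite inE => /andP[Ki /fintype.subsetP sK].
  rewrite /free_step (_ : near_agents x i = K) //.
  by apply/setP => j; apply/idP/idP => [/sK//|]; exact: KK.
have far i : i \in B -> i \notin K0 -> a + 2^-1 / N%:R <= free_step x i.
  move=> Bi; rewrite inE negb_and => K0i.
  have [e ie Ke] : exists2 e, e \in near_agents x i & e \notin K.
    have [Ki|Ki] := boolP (i \in K); last by exists i => //; exact: near_refl.
    by move: K0i; rewrite Ki /= => /fintype.subsetPn.
  have Bj j : j \in near_agents x i -> j \in B by exact: near_isolated.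
  apply: (mean_ge_jump (near_refl x i)) => //; last first.
  (* Beyond [K], agent [e] alone contributes more than 1/2, as [m + 1 < x e] and [a <= m + 2^-1].
     Inside [K], agent [i] sees either everything or an upper part, whose mean is at least [a]. *)
  - rewrite (bigID (mem K)) /= [X in _ <= _ + X](bigD1 e) /=; last by rewrite ie Ke.
    have Be := nK _ (Bj _ ie) Ke.
    apply: ler_wpDl; last first.
      apply: ler_wpDr; last by lra.
      apply: sumr_ge0 => j /andP[/andP[ij Kj] _].
      by have := nK _ (Bj _ ij) Kj => ?; lra.
    rewrite (eq_bigl (mem (near_agents x i :&: K))); last first.
      by move=> j; rewrite /= finset.in_setI.
    have [->|[j0 j0iK]] := set_0Vmem (near_agents x i :&: K).
      by rewrite big1 // => j; rewrite /= inE.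
    rewrite -(le_mean _ _ j0iK); apply: (mean_mono (near_refl x i0) j0iK).
      move=> b c Kb iKb /finset.setIP[ic Kc].
      move: iKb; rewrite inE Kb andbT => ib.
      have Ki : i \notin K by apply/negP => Ki; move/negP: ib; apply; exact: KK.
      have := nK _ Bi Ki; have := Km _ Kb; have := Km _ Kc; move: ib ic.
      rewrite !inE -ltNge ler_norml ltr_normr => ib /andP[? ?] ? ? ?.
      by case/orP: ib => ?; lra.
    by move=> b c Kb /finset.setIP[_ Kc]; rewrite Kc.
  - by apply: leq_trans BN; apply/subset_leq_card/fintype.subsetP.
have K0i0 : i0 \in K0 by rewrite inE near_refl /=.
have K0B : K0 \subset B by apply/fintype.subsetP => i; rewrite inE => /andP[/KB].
have i1 := isolated_step iB.
(* Either another agent ends up within 1 of [a], and the second step gains through [min_jump], or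
   [K0] has split off. *)
have [[j [Bj K0j ja]]|/forallNP nex'] := pselect (exists j,
    [/\ j \in B, j \notin K0 & free_step x j <= a + 1]); [left|right].
  have j' : a + 2^-1 / N%:R <= free_step x j <= a + 1 by rewrite far.
  have ha : {in B, forall i, a <= free_step x i}.
    by move=> i Bi; apply: free_step_mono; rewrite xi0 hm.
  have d0 : 0 <= 2^-1 / N%:R :> R by rewrite divr_ge0 ?invr_ge0.
  move=> i Bi; apply: le_trans (min_jump i1 BN ha Bi0 erefl Bj d0 j' Bi).
  by rewrite lerD2r.
exists K0; split => // [i j K0i K0j|i j /K0a-> /K0a->]; last by left.
have [Bj|Bj] := boolP (j \in B); last by apply: i1 => //; exact: (fintype.subsetP K0B).
rewrite K0a // distrC ltr_normr; apply/orP; left; rewrite ltrBrDl ltNge.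
by apply/negP => ?; apply: (nex' j).
Qed.

(* Two steps either raise the lower bound [m] by [1 / (2 N^2)] or shrink [B], so
   they lower the left-hand side of the last hypothesis by at least 1. *)
Lemma converged_on_iter_measure k x B m M N : isolated_group x B -> (#|B| <= N)%N ->
  {in B, forall i, m <= x i <= M} ->
  2 * N%:R ^+ 2 * (M - m) + #|B|%:R <= k%:R ->
  converged_on (iter k.*2 free_step x) B.
Proof.
elim: k x B m => [|k IH] x B m iB BN hB hk.
  (* An inhabited [B] has positive measure, so the base case is vacuous. *)
  move=> i j Bi _; exfalso; move: hk; apply/negP; rewrite -ltNge.
  apply: ltr_wpDl; last by rewrite ltr0n; apply/card_gt0P; exists i.
  have /andP[? ?] := hB i Bi.
  by rewrite mulr_ge0 ?mulr_ge0 ?exprn_ge0 ?ler0n ?subr_ge0; lra.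
have [->|[b Bb]] := set_0Vmem B; first by move=> i j; rewrite inE.
have N1 : 1 <= N%:R :> R.
  by rewrite ler1n (leq_trans _ BN) //; apply/card_gt0P; exists b.
have [i0 Bi0 hmin] : exists2 i0, i0 \in B & {in B, forall i, x i0 <= x i}.
  by case: (arg_minP x Bb) => i0 Bi0 h; exists i0.
have hM : {in B, forall i, x i <= M} by move=> i /hB/andP[].
have [hj|[K [KB Ki0 iK cK]]] := min_jump_or_split iB BN hmin Bi0 erefl.
  rewrite doubleS -addn2 iterD /=.
  apply: (IH _ _ (m + 2^-1 / N%:R / N%:R)) => //.
  - by do 2!apply: isolated_step.
  - move=> i Bi; apply/andP; split.
      apply: le_trans (hj i Bi); rewrite lerD2r.
      by case/andP: (hB _ Bi0).
    by apply: (free_step_le (isolated_step iB)) => //; exact: free_step_le.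
  - have e : 2 * N%:R ^+ 2 * (2^-1 / N%:R / N%:R) = 1 :> R.
      by field; rewrite gt_eqF //; lra.
    by rewrite opprD addrA mulrBr e; move: hk; rewrite -natr1; lra.
have i1 := isolated_step iB.
(* The split happens after one step; the other step of the pair is spent at the end, where
   convergence persists. *)
rewrite doubleS iterS iterSr.
apply: (converged_iter 1 (isolated_iter _ i1)).
apply: (converged_on_setD (K := K)); [exact: isolated_iter|exact: converged_iter|].
apply: (IH _ _ m); first exact: isolated_setD.
- by rewrite (leq_trans _ BN) // subset_leq_card // finset.subsetDl.
- move=> i; rewrite finset.in_setD => /andP[_ Bi]; apply/andP; split.
    by apply: (free_step_ge iB) => // j /hB/andP[].
  exact: (free_step_le iB).
- have lt : (#|B :\: K| < #|B|)%N.
    apply: proper_card; rewrite properE finset.subsetDl /=.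
    apply/fintype.subsetPn; exists i0 => //.
    by rewrite finset.in_setD Ki0.
  move: hk; rewrite -natr1.
  have : #|B :\: K|%:R + 1 <= #|B|%:R :> R by rewrite natr1 ler_nat.
  lra.
Qed.

End Free.

(** * Gaps and untouched stretches under strategic influence *)

Section Controlled.
Variables (R : realType) (n m : nat).
Implicit Types (x : 'I_n -> R) (y : 'I_m -> R) (c lo hi : nat).

Lemma neighbours_refl x y i : inl i \in neighbours x y i.
Proof. by rewrite inE subrr normr0. Qed.

Lemma hk_step_mean x y i :
  hk_step x y i = mean (neighbours x y i) (opinion x y).
Proof. by []. Qed.

(** Strict because the agent counts itself in the average. This caps the speed at which disturbed
    agents invade the chain. *)
Lemma hk_step_lt x y i : hk_step x y i < x i + 1.
Proof.
apply: (mean_lt (neighbours_refl x y i)) => /= [a|]; last by lra.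
by rewrite inE ler_norml => /andP[? ?]; lra.
Qed.

Lemma hk_step_gt x y i : x i - 1 < hk_step x y i.
Proof.
apply: (mean_gt (neighbours_refl x y i)) => /= [a|]; last by lra.
by rewrite inE ler_norml => /andP[? ?]; lra.
Qed.

Lemma hk_step_free x y i : (forall s, 1 < `|x i - y s|) ->
  hk_step x y i = free_step x i.
Proof.
move=> far; have -> : hk_step x y i = mean (inl @: near_agents x i) (opinion x y).
  congr mean; apply/setP => -[j|s].
    rewrite inE mem_imset ?inE // => a b; exact: inl_inj.
  rewrite inE /= leNgt far; apply/esym/negbTE/imsetP => -[j _].
  by [].
rewrite /free_step /mean big_imset ?card_imset //=; first exact: inl_inj.
by move=> a b _ _; exact: inl_inj.
Qed.

Lemma hkD x (z : nat -> 'I_m -> R) t u :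
  hk x z (t + u) = hk (hk x z t) (fun r => z (t + r)%N) u.
Proof. by elim: u => [|u IH]; rewrite ?addn0 // addnS /= IH. Qed.

(** Free steps preserve the bound [b], so strategic agents beyond [b + 1] are never seen; the
    induction carries both facts together. *)
Lemma hk_free x (z : nat -> 'I_m -> R) b t : (forall i, x i <= b) ->
  (forall t s, b + 1 < z t s) -> hk x z t = iter t (@free_step R 'I_n) x.
Proof.
move=> xb zb; suff : hk x z t = iter t (@free_step R 'I_n) x /\
    (forall i, hk x z t i <= b) by case.
elim: t => [//|t [IH hb]] /=.
have e : hk_step (hk x z t) (z t) = free_step (hk x z t).
  apply/funext => i; apply: hk_step_free => s.
  have := zb t s; have := hb i => ? ?.
  by rewrite ltr_normr; apply/orP; right; lra.
split; first by rewrite e IH.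
move=> i; rewrite e; apply: (@free_step_le _ _ _ [set: 'I_n]) => //.
by move=> j k _; rewrite inE.
Qed.

(** Fixed bounds rather than pairwise distances: they persist from step to step and also bound the
    diameter of a block between two gaps. *)
Definition gap_at x (u v : R) c :=
  u + 1 < v /\ forall i : 'I_n, if (i < c)%N then x i <= u else v <= x i.

(** Nobody sees across the gap, and no strategic agent stands inside it as a bridge, so each side
    averages opinions of its own side only. *)
Lemma gap_at_step x y u v c : gap_at x u v c -> (forall s, y s <= u \/ v <= y s) ->
  gap_at (hk_step x y) u v c.
Proof.
move=> [uv h] hy; split => // i; have := h i.
case: ifP => ic hi.
  apply: (mean_le (neighbours_refl x y i)) => -[j|s]; rewrite inE /=;
      rewrite ler_norml => /andP[? ?].
    by have := h j; case: ifP => // _ ?; exfalso; lra.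
  by have [//|?] := hy s; exfalso; lra.
apply: (mean_ge (neighbours_refl x y i)) => -[j|s]; rewrite inE /=;
    rewrite ler_norml => /andP[? ?].
  by have := h j; case: ifP => // _ ?; exfalso; lra.
by have [?|//] := hy s; exfalso; lra.
Qed.

(** The strict bounds keep the remaining agents out of sight of the agents strictly between [lo] and
    [hi]. *)
Definition untouched x lo hi := (hi < n)%N /\
  forall i : 'I_n, [/\ (lo <= i <= hi)%N -> x i = i%:R,
    (i < lo)%N -> x i < lo%:R & (hi < i)%N -> hi%:R < x i].

Lemma untouched_le x lo hi (i : 'I_n) : untouched x lo hi -> (i <= lo <= hi)%N ->
  x i <= lo%:R.
Proof.
move=> [_ /(_ i)[e l _]] /andP[]; rewrite leq_eqVlt => /orP[/eqP il|/l/ltW//].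
by move=> lohi; rewrite e il ?leqnn.
Qed.

Lemma untouched_ge x lo hi (i : 'I_n) : untouched x lo hi -> (lo <= hi <= i)%N ->
  hi%:R <= x i.
Proof.
move=> [_ /(_ i)[e _ r]] /andP[lohi]; rewrite leq_eqVlt => /orP[/eqP ih|/r/ltW//].
by rewrite e -ih ?lohi ?leqnn.
Qed.

Lemma near_untouched x lo hi (i j : 'I_n) : untouched x lo hi ->
  (lo < i < hi)%N -> (`|x i - x j| <= 1) = ((i <= j.+1) && (j <= i.+1))%N.
Proof.
move=> [_ h] lih; have [xi _ _] := h i; rewrite {}xi; last by lia.
have [e l r] := h j.
have [jlo|jlo] := ltnP j lo.
  have -> : ((i <= j.+1) && (j <= i.+1))%N = false by lia.
  apply/negbTE; rewrite -ltNge ltr_normr; apply/orP; left.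
  have := l jlo; have : lo%:R + 1 <= i%:R :> R by rewrite natr1 ler_nat; lia.
  lra.
have [jhi|jhi] := ltnP hi j.
  have -> : ((i <= j.+1) && (j <= i.+1))%N = false by lia.
  apply/negbTE; rewrite -ltNge ltr_normr; apply/orP; right.
  have := r jhi; have : i%:R + 1 <= hi%:R :> R by rewrite natr1 ler_nat; lia.
  lra.
rewrite e ?jlo // ler_norml -(ler_nat R i) -(ler_nat R j) -!natr1.
by apply/andP/andP => -[? ?]; split; lra.
Qed.

(** The chain agents [i - 1], [i], [i + 1] are symmetric about [i] and cancel, so only strategic
    agents displace [i]; the 3 counts this triple. *)
Lemma hk_step_untouched x y lo hi (i : 'I_n) : untouched x lo hi ->
  (lo < i < hi)%N ->
  let S := [set s | `|i%:R - y s| <= 1] in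
  hk_step x y i = i%:R + (\sum_(s in S) (y s - i%:R)) / (#|S| + 3)%:R.
Proof.
move=> U lih S; have [hin h] := U; have [xi _ _] := h i.
have {}xi : x i = i%:R by apply: xi; lia.
have i1P : (i.-1 < n)%N by lia.
have i2P : (i.+1 < n)%N by lia.
pose i1 := Ordinal i1P; pose i2 := Ordinal i2P.
have xi1 : x i1 = i%:R - 1.
  have [-> /=] := h i1; [|by lia].
  by rewrite -subn1 natrB //; lia.
have xi2 : x i2 = i%:R + 1.
  by have [-> /=] := h i2; [rewrite natr1|lia].
pose A : {set 'I_n + 'I_m} := [set inl i1; inl i; inl i2].
have nbE : neighbours x y i = A :|: inr @: S.
  apply/setP => -[j|s]; rewrite !inE /=.
    rewrite (near_untouched _ U lih) !(inj_eq (@inl_inj _ _)) -!val_eqE /=.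
    suff -> : (inl j \in [set inr a | a in S]) = false by lia.
    by apply/imsetP => -[].
  by rewrite xi mem_imset ?inE //; exact: inr_inj.
have dis : [disjoint A & inr @: S].
  rewrite finset.disjoints_subset; apply/fintype.subsetP => -[j|s]; rewrite !inE //= => _.
  by apply/imsetP => -[].
have neq : [/\ (i.-1 == i.+1 :> nat) = false, (i.-1 == i :> nat) = false &
    (i == i.+1 :> nat) = false] by split; lia.
have sumA : \sum_(a in A) (opinion x y a - i%:R) = 0.
  rewrite /A -finset.setUA !big_setU1 ?big_set1 /= ?inE;
    rewrite ?(inj_eq (@inl_inj _ _)) -?val_eqE /=; [|by lia|by lia].
  by rewrite xi1 xi2 xi; ring.
have cardA : #|A| = 3.
  rewrite /A -finset.setUA !cardsU1 cards1 !inE !(inj_eq (@inl_inj _ _)).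
  by rewrite -!val_eqE /=; case: neq => -> -> ->.
apply/eqP; rewrite [X in _ == X]addrC -subr_eq; apply/eqP.
rewrite hk_step_mean (mean_sub _ _ (neighbours_refl x y i)) nbE.
rewrite (eq_bigl [predU A & inr @: S]) => [|a]; last by rewrite !inE.
rewrite bigU //= sumA add0r big_imset /=; last by move=> a b _ _; exact: inr_inj.
rewrite cardsU finset.disjoint_setI0 // cards0 subn0 cardA addnC card_imset //.
exact: inr_inj.
Qed.

Lemma hk_step_untouched_far x y lo hi (i : 'I_n) : untouched x lo hi ->
  (lo < i < hi)%N -> (forall s, 1 < `|i%:R - y s|) -> hk_step x y i = i%:R.
Proof.
move=> U lih far; rewrite (hk_step_untouched _ U lih) big_pred0 ?mul0r ?addr0 //.
by move=> s; rewrite inE leNgt far.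
Qed.

(** Agents strictly inside are balanced by their two neighbours; all others move by less than 1 and
    so stay strictly outside the range shortened by one at each end. *)
Lemma untouched_step x y lo hi : untouched x lo hi -> (lo < hi)%N ->
  (forall s (i : 'I_n), (lo < i < hi)%N -> 1 < `|i%:R - y s|) ->
  untouched (hk_step x y) lo.+1 hi.-1.
Proof.
move=> U lohi far; have [hin h] := U; split; first by lia.
move=> i; split => ii.
- by apply: (hk_step_untouched_far U) => [|s]; [lia|apply: far; lia].
- apply: lt_le_trans (hk_step_lt _ _ _) _; rewrite -natr1 lerD2r.
  by apply: untouched_le U _; lia.
- apply: le_lt_trans (hk_step_gt _ y _); rewrite -subn1 natrB; last by lia.
  by rewrite lerD2r; apply: untouched_ge U _; lia.
Qed.

End Controlled.

(** * Cutting the chain with one strategic agent *)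

Section OneStrategic.
Variables (R : realType) (n : nat).
Implicit Types (x : 'I_n -> R) (y : 'I_1 -> R) (lo hi p : nat).

Lemma hk_step_at x y lo hi p (i : 'I_n) : untouched x lo hi ->
  (lo < i < hi)%N -> y ord0 = p%:R -> hk_step x y i =
  if ((i <= p.+1) && (p <= i.+1))%N then i%:R + (p%:R - i%:R) / 4 else i%:R.
Proof.
move=> U lih yp; have e : (`|i%:R - y ord0| <= 1) = ((i <= p.+1) && (p <= i.+1))%N.
  rewrite yp ler_norml -(ler_nat R i) -(ler_nat R p) -!natr1.
  by apply/andP/andP => -[? ?]; split; lra.
case: ifP => h; last first.
  apply: (hk_step_untouched_far U lih) => s.
  by rewrite ord1 ltNge e h.
rewrite (hk_step_untouched _ U lih).
have -> : [set s | `|i%:R - y s| <= 1] = [set ord0].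
  by apply/setP => s; rewrite !inE ord1 e h.
by rewrite big_set1 cards1 yp.
Qed.

(** The extreme case is agent [p + 1], pulled back by 1/4. Agents up to [lo] move by less than 1 and
    remain below [p - 1]. *)
Lemma hk_step_left x y lo hi p (i : 'I_n) : untouched x lo hi ->
  y ord0 = p%:R -> (lo.+2 <= p)%N -> (p.+2 <= hi)%N -> (i <= p.+1)%N ->
  hk_step x y i <= p%:R + 3 / 4.
Proof.
move=> U yp lop phi ip; have [ilo|loi] := leqP i lo.
  apply/ltW/(lt_le_trans (hk_step_lt _ _ _)).
  have := @untouched_le _ _ _ _ _ i U; have : lo%:R + 1 + 1 <= p%:R :> R.
    by rewrite !natr1 ler_nat.
  by move=> ? h; have := h ltac:(lia); lra.
rewrite (hk_step_at (p := p) U) //; last by lia.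
have : i%:R <= p%:R + 1 :> R by rewrite natr1 ler_nat.
case: ifP => [_ ?|]; first by lra.
by move=> h _; have : i%:R + 1 <= p%:R :> R; [rewrite natr1 ler_nat; lia|lra].
Qed.

Lemma hk_step_right x y lo hi p (i : 'I_n) : untouched x lo hi ->
  y ord0 = p%:R -> (lo.+2 <= p)%N -> (p.+2 <= hi)%N -> (p <= i.+1)%N ->
  p%:R - 3 / 4 <= hk_step x y i.
Proof.
move=> U yp lop phi ip; have [ihi|hii] := leqP hi i.
  apply/ltW/(le_lt_trans _ (hk_step_gt _ _ _)).
  have := @untouched_ge _ _ _ _ _ i U; have : p%:R + 1 + 1 <= hi%:R :> R.
    by rewrite !natr1 ler_nat.
  by move=> ? h; have := h ltac:(lia); lra.
rewrite (hk_step_at (p := p) U) //; last by lia.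
have : p%:R <= i%:R + 1 :> R by rewrite natr1 ler_nat.
case: ifP => [_ ?|]; first by lra.
by move=> h _; have : p%:R + 1 <= i%:R :> R; [rewrite natr1 ler_nat; lia|lra].
Qed.

(* A strategic agent sitting on agent [p] pulls the agents [p - 1] and [p + 1]
   inwards by 1/4, opening gaps of length 5/4 on both sides of the triple. *)
Lemma cut_left x y lo hi p : untouched x lo hi ->
  y ord0 = p%:R -> (lo.+2 <= p)%N -> (p.+3 <= hi)%N ->
  untouched (hk_step x y) p.+2 hi.-1 /\
  gap_at (hk_step x y) (p%:R + 3 / 4) p.+2%:R p.+2.
Proof.
move=> U yp lop phi; have [hin h] := U.
have hp : p%:R + 1 + 1 + 1 <= hi%:R :> R by rewrite !natr1 ler_nat.
have pS : p.+2%:R = p%:R + 1 + 1 :> R by rewrite !natr1.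
have L (i : 'I_n) : (i < p.+2)%N -> hk_step x y i <= p%:R + 3 / 4.
  by move=> ?; apply: (hk_step_left U) => //; lia.
have M (i : 'I_n) : (p.+2 <= i <= hi.-1)%N -> hk_step x y i = i%:R.
  by move=> ?; rewrite (hk_step_at (p := p) U) //; [case: ifP => //|]; lia.
have H (i : 'I_n) : (hi.-1 < i)%N -> hi.-1%:R < hk_step x y i.
  move=> ?; apply: le_lt_trans (hk_step_gt _ y _); rewrite -subn1 natrB; last by lia.
  by rewrite lerD2r; apply: untouched_ge U _; lia.
split; split.
- by lia.
- by move=> i; split; [exact: M|move=> /L; rewrite pS; lra|exact: H].
- by rewrite pS; lra.
- move=> i; case: ifP => [/L //|pi].
  have [/H/ltW|?] := ltnP hi.-1 i.
    by apply: le_trans; rewrite ler_nat; lia.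
  by rewrite M ?ler_nat; lia.
Qed.

(** Mirror image of [cut_left], recording the gap between agents [p - 2] and [p - 1]. *)
Lemma cut_right x y lo hi p : untouched x lo hi ->
  y ord0 = p%:R -> (lo.+3 <= p)%N -> (p.+2 <= hi)%N ->
  untouched (hk_step x y) lo.+1 p.-2 /\
  gap_at (hk_step x y) (p%:R - 2) (p%:R - 3 / 4) p.-1.
Proof.
move=> U yp lop phi; have [hin h] := U.
have hp : lo%:R + 1 + 1 + 1 <= p%:R :> R by rewrite !natr1 ler_nat.
have pS : p.-2%:R = p%:R - 2 :> R by rewrite -subn2 natrB //; lia.
have L (i : 'I_n) : (p.-2 < i)%N -> p%:R - 3 / 4 <= hk_step x y i.
  by move=> ?; apply: (hk_step_right U) => //; lia.
have M (i : 'I_n) : (lo.+1 <= i <= p.-2)%N -> hk_step x y i = i%:R.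
  by move=> ?; rewrite (hk_step_at (p := p) U) //; [case: ifP => //|]; lia.
have H (i : 'I_n) : (i < lo.+1)%N -> hk_step x y i < lo.+1%:R.
  move=> ?; apply: lt_le_trans (hk_step_lt _ _ _) _; rewrite -natr1 lerD2r.
  by apply: untouched_le U _; lia.
split; split.
- by lia.
- by move=> i; split; [exact: M|exact: H|move=> /L; rewrite pS; lra].
- by lra.
- move=> i; case: ifP => [pi|pi]; last by apply: L; lia.
  rewrite -pS; have [/H/ltW/le_trans|?] := ltnP i lo.+1.
    by apply; rewrite ler_nat; lia.
  by rewrite M ?ler_nat; lia.
Qed.

End OneStrategic.

(** * Convergence of a block between two gaps *)

Section Blocks.
Variables (R : realType) (n : nat).
Implicit Types (x : 'I_n -> R) (c : nat).

(* [300 W^3] dominates [2 (2 N^2 D + N)] for [N = D = 4 W]. *)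
Lemma block_converged x u v u' v' c c' W t :
  gap_at x u v c -> gap_at x u' v' c' -> c%:R <= v -> u' <= c'%:R ->
  (c' - c < 4 * W)%N -> (300 * W ^ 3 <= t)%N ->
  let B := [set i : 'I_n | c <= i < c']%N in
  isolated_group (iter t (@free_step R 'I_n) x) B /\
  converged_on (iter t (@free_step R 'I_n) x) B.
Proof.
move=> [uv hc] [uv' hc'] cv uc cW tW B.
have xB : {in B, forall i, v <= x i <= u'}.
  move=> i; rewrite inE => /andP[ci ic].
  have := hc i; rewrite ltnNge ci /= => ->.
  by have := hc' i; rewrite ic.
have iB : isolated_group x B.
  move=> i j Bi; have /andP[vi iu] := xB i Bi; rewrite inE negb_and -!ltnNge.
  rewrite ltr_normr; case/orP => cj; apply/orP.
    by left; have := hc j; rewrite cj => ?; lra.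
  by right; have := hc' j; case: ifP => [?|_ ?]; [exfalso; lia|lra].
have BW : (#|B| <= 4 * W)%N.
  rewrite (leq_trans _ cW) //.
  pose f (i : 'I_n) : 'I_(c' - c).+1 := inord (i - c).
  have := max_card (mem (f @: B)); rewrite card_ord card_in_imset //.
  move=> i j; rewrite !inE => ? ? /(congr1 val); rewrite /= !inordK; [|lia|lia].
  by move=> ?; apply/val_inj => /=; lia.
split; first exact: isolated_iter.
rewrite -(subnK tW) iterD; apply: converged_iter; first exact: isolated_iter.
rewrite (_ : 300 * W ^ 3 = (150 * W ^ 3).*2)%N; last by rewrite -muln2; lia.
apply: (converged_on_iter_measure (m := c%:R) (M := c'%:R)) (BW) _ _ => //.
  by move=> i /xB/andP[? ?]; apply/andP; split; lra.
apply: (@le_trans _ _ (2 * (4 * W) ^ 2 * (4 * W) + 4 * W)%N%:R); last first.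
  (* [cW] forces [0 < W], hence [128 * W ^ 3 + 4 * W <= 150 * W ^ 3]. *)
  by rewrite ler_nat !expnS expn0; nia.
rewrite natrD; apply: lerD; last by rewrite ler_nat.
rewrite [leRHS]natrM [X in _ <= X * _]natrM natrX ler_wpM2l //.
by rewrite lerBlDr -natrD ler_nat; lia.
Qed.

End Blocks.

(** * The cutting strategy and its invariant *)

Section Strategy.
Variables (R : realType) (n W : nat).
Implicit Types (x : 'I_n -> R).

(** The pulled triple must be the inner end of the block being cut off: on the left its last agent
    is [k.+1 * W - 1], on the right its first agent is [n - k.+1 * W]. *)
Definition left_target k := (k.+1 * W - 2)%N.
Definition right_target k := (n - k.+1 * W + 1)%N.

(* In round [k] (times [2k] and [2k + 1]) the agent first cuts off the block
   [kW, (k+1)W), then its mirror image; after [K] rounds it leaves for good. *)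
Definition strategy K (t : nat) : 'I_1 -> R := fun=>
  if (t < K.*2)%N then
    (if odd t then right_target t./2 else left_target t./2)%:R
  else n.+2%:R.

(** The untouched range starts at [(k * W).+1] because the left cut comes first and its disturbance
    advances by one agent during the right cut. The gaps for [j = 0] are the two ends of the whole
    chain. *)
Definition swept k x :=
  [/\ untouched x (k * W).+1 (n - k * W).-1,
    forall j, (j <= k)%N -> gap_at x ((j * W)%:R - 5 / 4) (j * W)%:R (j * W) &
    forall j, (j <= k)%N ->
      gap_at x ((n - j * W)%:R - 1) ((n - j * W)%:R + 1 / 4) (n - j * W)].

Lemma swept0 : (2 < n)%N -> swept 0 (@equidistant R n).
Proof.
move=> n1; rewrite /swept mul0n subn0; split.
- split; first lia.
  move=> i; split => // ?; rewrite /equidistant ltr_nat; lia.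
- move=> j; rewrite leqn0 => /eqP->; rewrite mul0n; split; first by lra.
  by move=> i; rewrite ltn0 ler0n.
- move=> j; rewrite leqn0 => /eqP->; rewrite mul0n subn0; split; first by lra.
  by move=> i; rewrite ltn_ord lerBrDr natr1 ler_nat ltn_ord.
Qed.

(** [4 < W] keeps both targets ahead of the disturbance on their own side; the lower bound on [n] is
    exactly the condition [lo.+3 <= p] of [cut_right]. *)
Lemma swept_step k x (y z : 'I_1 -> R) : (4 < W)%N ->
  (2 * (k.+1 * W) + 2 <= n)%N -> swept k x ->
  y ord0 = (left_target k)%:R -> z ord0 = (right_target k)%:R ->
  swept k.+1 (hk_step (hk_step x y) z).
Proof.
rewrite /left_target /right_target => W5 kn [U lc rc] yp zq.
have kW : (k.+1 * W = k * W + W)%N by rewrite mulSn addnC.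
have [U1 lc1] : untouched (hk_step x y) (k.+1 * W) (n - k * W).-2 /\
    gap_at (hk_step x y) ((k.+1 * W)%:R - 5 / 4) (k.+1 * W)%:R (k.+1 * W).
  have [] := cut_left (p := k.+1 * W - 2) U yp; [lia|lia|].
  have -> : (k.+1 * W - 2).+2 = (k.+1 * W)%N by lia.
  move=> U1 c1; split => //; rewrite (_ : _ - _ = (k.+1 * W - 2)%:R + 3 / 4) //.
  by rewrite natrB; [lra|lia].
have [U2 rc2] := cut_right (p := n - k.+1 * W + 1) U1 zq ltac:(lia) ltac:(lia).
have le_jk j : (j <= k)%N -> (j * W <= k * W)%N by move=> ?; rewrite leq_mul2r; lia.
split.
- by rewrite (_ : (n - k.+1 * W).-1 = (n - k.+1 * W + 1).-2) //; lia.
(* Later targets lie to the right of every left gap already open, so they never bridge it; the right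
   gaps are treated symmetrically. *)
- move=> j jk; apply: gap_at_step => [|s].
    have [->//|{}jk] : j = k.+1 \/ (j <= k)%N by lia.
    apply: gap_at_step => [|s]; first exact: lc.
    by right; rewrite ord1 yp ler_nat; have := le_jk j jk; lia.
  right; rewrite ord1 zq ler_nat.
  have : (j * W <= k.+1 * W)%N by rewrite leq_mul2r; lia.
  by lia.
- move=> j jk; have [->|{}jk] : j = k.+1 \/ (j <= k)%N by lia.
    rewrite (_ : (n - k.+1 * W)%N = (n - k.+1 * W + 1).-1); last by lia.
    have e : (n - k.+1 * W + 1).-1%:R = (n - k.+1 * W + 1)%:R - 1 :> R.
      by rewrite -subn1 natrB //; lia.
    rewrite e (_ : _ - 1 - 1 = (n - k.+1 * W + 1)%:R - 2); last by lra.
    by rewrite (_ : _ - 1 + 1 / 4 = (n - k.+1 * W + 1)%:R - 3 / 4) //; lra.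
  have ? := le_jk j jk.
  have e : (n - j * W)%:R - 1 = (n - j * W).-1%:R :> R.
    by rewrite -subn1 [RHS]natrB //; lia.
  apply: gap_at_step => [|s].
    apply: gap_at_step => [|s]; first exact: rc.
    by left; rewrite e ord1 yp ler_nat; lia.
  by left; rewrite e ord1 zq ler_nat; lia.
Qed.

Lemma swept_strategy K : (4 < W)%N -> (2 < n)%N -> (2 * (K * W) + 2 <= n)%N ->
  swept K (hk (@equidistant R n) (strategy K) K.*2).
Proof.
move=> W5 n1 Kn; suff h k : (k <= K)%N ->
    swept k (hk (@equidistant R n) (strategy K) k.*2) by exact: h.
elim: k => [_|k IH kK]; first exact: swept0.
rewrite doubleS /=; apply: swept_step => //.
- have : (k.+1 * W <= K * W)%N by rewrite leq_mul2r kK orbT.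
  by lia.
- exact/IH/ltnW.
- by rewrite /strategy odd_double doubleK ifT //; lia.
- by rewrite /strategy /= odd_double /= uphalf_double ifT //; lia.
Qed.

(** The recorded gaps split the agents into left blocks, a middle remainder of fewer than
    [2 * W + 2] agents, and right blocks. All of them converge in parallel, and isolation handles
    pairs from different blocks. *)
Lemma strategy_converged K : (4 < W)%N -> (2 < n)%N ->
  (2 * (K * W) + 2 <= n < 2 * (K * W) + 2 * W + 2)%N ->
  converged (hk (@equidistant R n) (strategy K) (K.*2 + 300 * W ^ 3)).
Proof.
move=> W5 n1 /andP[Kn nK]; have [_ lc rc] := swept_strategy W5 n1 Kn.
rewrite hkD; set x := hk _ _ K.*2 in lc rc *.
have xn i : x i <= n%:R.
  have [_ /(_ i)] := rc 0 isT; rewrite mul0n subn0 ltn_ord; lra.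
rewrite (hk_free (b := n%:R)) // => [|t s]; last first.
  by rewrite /strategy ifF -?natr1; [lra|lia].
suff h (i : 'I_n) : exists B : {set 'I_n}, [/\ i \in B,
    isolated_group (iter (300 * W ^ 3) (@free_step R 'I_n) x) B &
    converged_on (iter (300 * W ^ 3) (@free_step R 'I_n) x) B].
  move=> i j; have [B [Bi iB cB]] := h i.
  by have [Bj|Bj] := boolP (j \in B); [exact: cB|right; exact: iB].
have W0 : (0 < W)%N by lia.
have [iK|Ki] := ltnP i (K * W).
  have qK : (i %/ W < K)%N by rewrite ltn_divLR.
  have [] := block_converged (lc _ (ltnW qK)) (lc _ qK) (t := 300 * W ^ 3) (W := W).
  - by [].
  - by lra.
  - by rewrite mulSn; lia.
  - by [].
  move=> iB cB; eexists; split; [|exact: iB|exact: cB].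
  rewrite inE leq_divM mulSn addnC.
  by rewrite {1}(divn_eq i W) ltn_add2l ltn_pmod.
have [iK|{}Ki] := ltnP i (n - K * W).
  have [] := block_converged (lc _ (leqnn K)) (rc _ (leqnn K)) (t := 300 * W ^ 3) (W := W).
  - by [].
  - by lra.
  - by lia.
  - by [].
  by move=> iB cB; eexists; split; [|exact: iB|exact: cB]; rewrite inE Ki.
have := ltn_ord i => lt_in.
(* Right blocks are numbered from the right end, where agent [i] has rank [n.-1 - i]. *)
pose q := ((n.-1 - i) %/ W)%N.
have qK : (q < K)%N by rewrite ltn_divLR //; lia.
have qW : (q * W <= n.-1 - i < q * W + W)%N.
  by rewrite leq_divM {1}(divn_eq (n.-1 - i) W) ltn_add2l ltn_pmod.
have := qK; rewrite -(leq_pmul2r W0) mulSn => ?.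
have [] := block_converged (rc _ qK) (rc _ (ltnW qK)) (t := 300 * W ^ 3) (W := W).
- by lra.
- by lra.
- by rewrite mulSn; lia.
- by [].
move=> iB cB; eexists; split; [|exact: iB|exact: cB].
by rewrite inE mulSn; lia.
Qed.

End Strategy.

(** * Existence of convergence times and the lower bound *)

Section ConvergenceTime.
Variables (R : realType) (n : nat).

(** Provides some converging run for every [n], from which both minima exist; for [m = 0] the
    hypothesis is vacuous, for [m = 1] the agent is parked out of sight. *)
Lemma free_converges m (y : nat -> 'I_m -> R) :
  (forall t s, n%:R + 1 < y t s) ->
  exists t, converged (hk (@equidistant R n) y t).
Proof.
(* [k] is the measure of [converged_on_iter_measure] for the whole chain, with size and diameter
   bounded by [n]. *)
move=> far; pose k := (2 * n ^ 3 + n)%N; exists k.*2.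
rewrite (hk_free (b := n%:R)) // => [|i]; last by rewrite ler_nat ltnW.
move=> i j; apply: (converged_on_iter_measure (B := [set: 'I_n]) (m := 0)
  (M := n%:R) (N := n)); rewrite ?cardsT ?card_ord ?inE //.
- by move=> a b _; rewrite inE.
- by move=> a _; rewrite ler0n ler_nat ltnW.
- by rewrite subr0 -mulrA -exprSr /k natrD natrM natrX.
Qed.

Lemma convergence_time_exists m (x0 : 'I_n -> R) (y : nat -> 'I_m -> R) t :
  converged (hk x0 y t) -> exists2 t', (t' <= t)%N & is_convergence_time x0 y t'.
Proof.
move=> ct; have ex : exists t, `[< converged (hk x0 y t) >] by exists t; apply/asboolP.
exists (ex_minn ex); case: ex_minnP => t' /asboolP ct' min.
  exact/min/asboolP.
by split => // t'' /asboolP/min.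
Qed.

Lemma optimal_time_exists m (x0 : 'I_n -> R) (y : nat -> 'I_m -> R) t :
  converged (hk x0 y t) -> exists t', is_optimal_convergence_time m x0 t'.
Proof.
move=> /convergence_time_exists[t0 _ ct0].
have ex : exists t, `[< exists y, @is_convergence_time R n m x0 y t >].
  by exists t0; apply/asboolP; exists y.
exists (ex_minn ex); case: ex_minnP => t' /asboolP ct' min.
by split => // y' t'' ct''; apply/min/asboolP; exists y'.
Qed.

Lemma optimal_time_le m (x0 : 'I_n -> R) (y : nat -> 'I_m -> R) t t' :
  converged (hk x0 y t) -> is_optimal_convergence_time m x0 t' -> (t' <= t)%N.
Proof.
move=> /convergence_time_exists[t0 t0t ct0] [_ min].
exact: leq_trans (min _ _ ct0) t0t.
Qed.

Lemma untouched_hk t : (t.*2 < n)%N ->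
  untouched (hk (@equidistant R n) no_strategic t) t (n.-1 - t).
Proof.
elim: t => [|t IH] tn.
  split; first lia.
  by move=> i; split => // ?; rewrite /equidistant ltr_nat; lia.
rewrite subnS; apply: untouched_step => [||[]//]; first by apply: IH; lia.
by lia.
Qed.

(** As long as [t.*2.+1 < n], agents [t] and [t.+1] are both untouched, at distance exactly 1:
    neither equal nor separated. *)
Lemma equidistant_time_ge t :
  converged (hk (@equidistant R n) no_strategic t) -> (n <= t.*2.+1)%N.
Proof.
move=> ct; rewrite leqNgt; apply/negP => tn.
have [_ h] := untouched_hk (t := t) ltac:(lia).
have t1 : (t < n)%N by lia.
have t2 : (t.+1 < n)%N by lia.
have [e1 _ _] := h (Ordinal t1); have [e2 _ _] := h (Ordinal t2).
have [] := ct (Ordinal t1) (Ordinal t2); rewrite e1 ?e2 /=; try lia.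
  by move/eqP; rewrite eqr_nat; lia.
by rewrite -natr1 opprD addrA subrr add0r normrN normr1 ltxx.
Qed.

End ConvergenceTime.

(** * Balancing the two phases and the asymptotic bounds *)

Lemma optimal_time_bound (R : realType) (n W t : nat) :
  (4 < W)%N -> (W ^ 4 <= n < W.+1 ^ 4)%N ->
  is_optimal_convergence_time 1 (@equidistant R n) t -> (t <= 316 * W ^ 3)%N.
Proof.
move=> W5 /andP[Wn nW] opt.
have n2 : (2 < n)%N.
  by apply: leq_trans Wn; rewrite (leq_trans (ltnW (ltnW W5))) // -{1}[W]expn1 leq_exp2l //; lia.
(* As many rounds as the chain has room for. *)
pose K := ((n - 2) %/ (2 * W))%N.
have W2 : (0 < 2 * W)%N by lia.
have KW : (2 * (K * W) + 2 <= n < 2 * (K * W) + 2 * W + 2)%N.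
  have := leq_divM (n - 2) (2 * W); have := ltn_ceil (n - 2) W2.
  rewrite -/K mulSn; nia.
have := optimal_time_le (strategy_converged R W5 n2 KW) opt.
(* Here [K.*2 * W <= n < W.+1 ^ 4 <= (2 * W) ^ 4]; cutting costs [16 * W ^ 3] and the free phase
   [300 * W ^ 3]. *)
suff : (K.*2 <= 16 * W ^ 3)%N by lia.
have : (W.+1 ^ 4 <= (2 * W) ^ 4)%N by rewrite leq_exp2r //; lia.
rewrite expnMn => W16; rewrite -(leq_pmul2r (_ : 0 < W)%N); last by lia.
have : (16 * W ^ 3 * W = 2 ^ 4 * W ^ 4)%N by rewrite -mulnA -expnSr.
move=> ->; rewrite -muln2; lia.
Qed.

Local Open Scope classical_set_scope.
Local Open Scope ring_scope.

Theorem lemma10 (R : realType) :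
  exists T0 T1 : nat -> nat,
    [/\ forall n : nat, (1 <= n)%N ->
          is_convergence_time (@equidistant R n) no_strategic (T0 n),
        forall n : nat, (1 <= n)%N ->
          is_optimal_convergence_time 1 (@equidistant R n) (T1 n),
        (fun n : nat => (T0 n)%:R : R^o) \is 'Omega_\oo (fun n : nat => n%:R : R^o)
      & (fun n : nat => (T1 n)%:R : R^o) =O_\oo
          (fun n : nat => n%:R `^ (3 / 4) : R^o)].
Proof.
have /choice[T0 hT0] n : exists t,
    is_convergence_time (@equidistant R n) no_strategic t.
  have [t /convergence_time_exists[t' _ ?]] :=
    @free_converges R n 0 no_strategic (fun _ => fun s => False_ind _ (notF (ltn_ord s))).
  by exists t'.
have /choice[T1 hT1] n : exists t,
    is_optimal_convergence_time 1 (@equidistant R n) t.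
  have [|t /optimal_time_exists//] :=
    @free_converges R n 1 (fun _ _ => n%:R + 2).
  by move=> _ _; rewrite ltrD2l; lra.
exists T0, T1; split => //.
  (* From [n <= 2 * T0 n + 1], the constant 1/4 works once [2 <= n]. *)
  rewrite qualifE; apply/asboolP; exists 4^-1; first by rewrite invr_gt0.
  near=> n; rewrite !ger0_norm // ler_pdivrMl // -natrM ler_nat.
  have [/equidistant_time_ge + _] := hT0 n.
  have : (2 <= n)%N by near: n; exact: nbhs_infty_ge.
  lia.
apply/eqO_exP; exists 316 => //; near=> n.
have n5 : (5 ^ 4 <= n)%N by near: n; exact: nbhs_infty_ge.
(* [W] is the integer part of the fourth root of [n]; the threshold [5 ^ 4] ensures [4 < W]. *)
have exW : exists W, (W ^ 4 <= n)%N by exists 0%N.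
have ubW W : (W ^ 4 <= n)%N -> (W <= n)%N.
  by apply: leq_trans; case: W => // W; rewrite -{1}[W.+1]expn1 leq_pexp2l.
have [W Wn Wmax] := ex_maxnP exW ubW.
have W5 : (4 < W)%N by exact: Wmax.
have nW : (n < W.+1 ^ 4)%N by rewrite ltnNge; apply/negP => /Wmax; rewrite ltnn.
have TW : (T1 n <= 316 * W ^ 3)%N.
  by apply: (optimal_time_bound W5 _ (hT1 n)); rewrite Wn.
rewrite !ger0_norm ?powR_ge0 //.
apply: (@le_trans _ _ (316 * W ^ 3)%N%:R); first by rewrite ler_nat.
rewrite natrM ler_wpM2l //.
have -> : (W ^ 3)%:R = ((W ^ 4)%:R : R) `^ (3 / 4).
  rewrite !natrX -!powR_mulrn // -powRrM; congr (_ `^ _); lra.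
by rewrite ge0_ler_powR ?nnegrE ?ler_nat //; lra.
Unshelve. all: by end_near. Qed.
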